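(* For any integer $\ell\geq 4$ there exists a graph $G$ with a vertex $v$ such that $\gamma_g'(G)=\ell$ and $\gamma_g'(G-v)=\ell-2$.
   Context: Graphs are finite, simple and undirected. A vertex dominates itself and all its neighbors. The domination game on a graph $G$ is played by two players, Dominator and Staller, who alternately choose a vertex of $G$ such that each chosen vertex dominates at least one vertex that was not dominated by the previously chosen vertices. The game ends when all vertices of $G$ are dominated. Dominator wants the total number of chosen vertices to be as small as possible, Staller wants it to be as large as possible. Assuming both play optimally, $\gamma_g'(G)$ (the Staller-start game domination number) is the total number of vertices chosen when Staller moves first. $G-v$ denotes the graph obtained from $G$ by removing the vertex $v$ and all edges incident with it. *)

(* Defs.v *)
From mathcomp Require Import all_boot.

Set Implicit Arguments.
Unset Strict Implicit.
Unset Printing Implicit Defensive.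

Record sgraph := SGraph {
  vertex :> finType;
  adj : rel vertex;
  adj_sym : symmetric adj;
  adj_irrefl : irreflexive adj }.

Lemma bigminn_le (I : finType) (d : nat) (P : pred I) (F : I -> nat) (i : I) :
  P i -> \big[minn/d]_(j | P j) F j <= F i.
Proof.
rewrite unlock => Pi; have := mem_index_enum i.
elim: (index_enum I) => //= j s IHs; rewrite inE => /predU1P[<-|/IHs le].
  by rewrite Pi geq_minl.
by case: ifP => // _; apply: leq_trans (geq_minr _ _) le.
Qed.

Section VertexRemoval.
Variables (G : sgraph) (v : G).

Definition del_adj : rel {x : G | x != v} := fun x y => adj (val x) (val y).

Lemma del_adj_sym : symmetric del_adj.
Proof. by move=> x y; apply: adj_sym. Qed.

Lemma del_adj_irrefl : irreflexive del_adj.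
Proof. by move=> x; apply: adj_irrefl. Qed.

Definition del_vertex : sgraph := SGraph del_adj_sym del_adj_irrefl.

End VertexRemoval.

Inductive player := Dominator | Staller.

Definition opponent (p : player) : player :=
  match p with Dominator => Staller | Staller => Dominator end.

Section DominationGame.
Variable G : sgraph.
Implicit Types (S : {set G}) (v : G) (p : player).

Definition closed_nbhd v : {set G} := [set u | (u == v) || adj v u].

Definition dominated S : {set G} := \bigcup_(u in S) closed_nbhd u.

Definition legal S v : bool := ~~ (closed_nbhd v \subset dominated S).

(* Number of moves still to be made from the position in which S has been
   chosen and p is to move, truncated after n moves.  The default #|G| of the
   minimum is never smaller than an actual value (see [remaining_Dominator]). *)
Fixpoint remaining_upto (n : nat) (p : player) (S : {set G}) : nat :=
  if n is n'.+1 then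
    if dominated S == setT then 0
    else
      let after v := remaining_upto n' (opponent p) (v |: S) in
      match p with
      | Dominator => (\big[minn/#|G|]_(v | legal S v) after v).+1
      | Staller => (\max_(v | legal S v) after v).+1
      end
  else 0.

(* Every legal move dominates a new vertex, so the truncation is harmless. *)
Definition remaining p S : nat := remaining_upto #|~: dominated S| p S.

Lemma dominatedU1 v S : dominated (v |: S) = closed_nbhd v :|: dominated S.
Proof. by rewrite /dominated bigcup_setU big_set1. Qed.

Lemma legal_undominated S x : x \notin dominated S -> legal S x.
Proof.
by move=> xS; apply/subsetPn; exists x => //; rewrite inE eqxx.
Qed.

Lemma undominated_legal S :
  dominated S != setT -> exists x, legal S x.
Proof.
rewrite -subTset => /subsetPn[x _ /legal_undominated]; by exists x.
Qed.

Lemma legal_decr S v :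
  legal S v -> #|~: dominated (v |: S)| < #|~: dominated S|.
Proof.
case/subsetPn=> x xv xS; apply: proper_card; rewrite dominatedU1.
apply/properP; split; first by rewrite setCS subsetUr.
by exists x; rewrite in_setC ?xS // in_setU xv.
Qed.

Lemma remaining_upto_le n p S : remaining_upto n p S <= n.
Proof.
elim: n p S => // n IHn [] S /=; case: eqP => // /eqP nS; rewrite ltnS.
  have [x xS] := undominated_legal nS.
  exact: leq_trans (bigminn_le _ _ xS) (IHn _ _).
by apply/bigmax_leqP => v _.
Qed.

Lemma remaining_uptoE n p S :
  #|~: dominated S| <= n -> remaining_upto n p S = remaining p S.
Proof.
suff H k m : forall p S, #|~: dominated S| <= k -> #|~: dominated S| <= m ->
    remaining_upto k p S = remaining_upto m p S by move=> ?; apply: H.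
have done0 S' : #|~: dominated S'| <= 0 -> dominated S' == setT.
  by rewrite leqn0 cards_eq0 -setCT (inj_eq (can_inj (@setCK _))).
elim: k m => [|k IHk] [|m] p' S' //=.
- by move=> /done0 ->.
- by move=> _ /done0 ->.
move=> Sk Sm; case: eqP => // _.
have E v : legal S' v ->
    remaining_upto k (opponent p') (v |: S')
    = remaining_upto m (opponent p') (v |: S').
  by move=> /legal_decr lt; apply: IHk; rewrite -ltnS (leq_trans lt).
by case: p' E => E; rewrite (eq_bigr _ E).
Qed.

Lemma remaining_over p S : dominated S = setT -> remaining p S = 0.
Proof. by move=> DS; rewrite /remaining DS setCT cards0. Qed.

Lemma remainingE p S : dominated S != setT ->
  remaining p S =
    let after v := remaining (opponent p) (v |: S) in
    match p with
    | Dominator => (\big[minn/#|G|]_(v | legal S v) after v).+1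
    | Staller => (\max_(v | legal S v) after v).+1
    end.
Proof.
move=> nS; have := leqnSn #|~: dominated S|.
move/(remaining_uptoE p) <-; rewrite /= (negPf nS).
have E v : legal S v ->
    remaining_upto #|~: dominated S| (opponent p) (v |: S)
    = remaining (opponent p) (v |: S).
  by move=> /legal_decr lt; apply: remaining_uptoE; apply: ltnW.
by case: p E => E; rewrite (eq_bigr _ E).
Qed.

Lemma remaining_Dominator S : dominated S != setT ->
  (exists2 v, legal S v & remaining Dominator S = (remaining Staller (v |: S)).+1)
  /\ (forall v, legal S v ->
        remaining Dominator S <= (remaining Staller (v |: S)).+1).
Proof.
move=> nS; rewrite (remainingE _ nS) /=.
have [x xS] := undominated_legal nS.
have le v : legal S v ->
    \big[minn/#|G|]_(w | legal S w) remaining Staller (w |: S)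
      <= remaining Staller (v |: S).
  by move=> vS; apply: bigminn_le.
split=> //.
pose F v := remaining Staller (v |: S).
case: (arg_minnP F xS) => v vS minv; exists v => //.
congr _.+1; apply/eqP; rewrite eqn_leq le //=.
apply: (big_ind (fun m => F v <= m)) => [|a b Fa Fb|w wS].
- by apply: leq_trans (remaining_upto_le _ _ _) _; apply: max_card.
- by rewrite leq_min Fa.
- exact: minv.
Qed.

Lemma remaining_Staller S : dominated S != setT ->
  (exists2 v, legal S v & remaining Staller S = (remaining Dominator (v |: S)).+1)
  /\ (forall v, legal S v ->
        (remaining Dominator (v |: S)).+1 <= remaining Staller S).
Proof.
move=> nS; rewrite (remainingE _ nS) /=.
have [x xS] := undominated_legal nS.
split; last by move=> v vS; rewrite ltnS (bigmax_sup v).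
rewrite (bigmax_eq_arg x) //.
by case: arg_maxnP => // v vS _; exists v.
Qed.

Definition staller_start_gdn : nat := remaining Staller set0.

End DominationGame.

(* Main.v *)
Require Import Defs.
From mathcomp Require Import all_boot.

(* An isolated vertex lets a player pass.  Two isolated vertices add exactly 2
   to the length of the game, since a pass can be answered by a pass.  A single
   one is worth more to Staller when the Dominator-start game is the longer one:
   on C_6 (resp. the ladder P_2 x P_4) the Staller-start game lasts 2 (resp. 3)
   moves and the Dominator-start game 3 (resp. 4), so that by passing at once
   Staller obtains 2 additional moves.  Hence take for G one of these graphs
   plus an odd number of isolated vertices, and for v an isolated vertex. *)

Set Implicit Arguments.
Unset Strict Implicit.
Unset Printing Implicit Defensive.

(** * Optimal play, stated uniformly in the player *)

Definition no_worse p (a b : nat) :=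
  match p with Dominator => a <= b | Staller => b <= a end.

Lemma no_worse_refl p a : no_worse p a a.
Proof. by case: p => /=. Qed.

Lemma no_worse_anti p a b : no_worse p a b -> no_worse p b a -> a = b.
Proof. by case: p => /= ab ba; apply/eqP; rewrite eqn_leq ab ba. Qed.

(** Merges the recursions for the two players, so that the inductions below treat both at once. *)
Lemma best_move (G : sgraph) p (S : {set G}) : dominated S != setT ->
  exists v, [/\ legal S v,
    remaining p S = (remaining (opponent p) (v |: S)).+1
    & forall w, legal S w ->
        no_worse p (remaining (opponent p) (v |: S))
                   (remaining (opponent p) (w |: S))].
Proof.
case: p => nS; [have := remaining_Dominator nS | have := remaining_Staller nS];
  by case=> -[v vS E] all_w; exists v; split=> // w /all_w; rewrite E ltnS.
Qed.

(** Converse of [best_move]: to evaluate a position it suffices to exhibit one legal move and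
    compare it with all the others. *)
Lemma remaining_best (G : sgraph) p (S : {set G}) v k : legal S v ->
  remaining (opponent p) (v |: S) = k ->
  (forall w, legal S w -> no_worse p k (remaining (opponent p) (w |: S))) ->
  remaining p S = k.+1.
Proof.
move=> vS Ek min_k; have nS : dominated S != setT.
  by apply: contraNneq vS => ->; rewrite subsetT.
have [w [wS -> min_w]] := best_move p nS; congr _.+1.
by apply: (@no_worse_anti p); [rewrite -Ek; apply: min_w | apply: min_k].
Qed.

(** * Embeddings that miss only isolated vertices *)

Section IsolatedVertices.
Variables (G H : sgraph) (h : G -> H).
Hypothesis inj_h : injective h.
Hypothesis adj_h : forall x y, adj (h x) (h y) = adj x y.
Hypothesis isolated : forall y z, y \notin codom h -> ~~ adj y z.
Implicit Types (S : {set G}) (X : {set H}).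

Lemma codom_caseP (P : H -> Prop) :
  (forall x, P (h x)) -> (forall y, y \notin codom h -> P y) -> forall y, P y.
Proof.
move=> Ph Pn y; have [/codomP[x ->]|/Pn//] := boolP (y \in codom h).
exact: Ph.
Qed.

Lemma closed_nbhd_embed x : closed_nbhd (h x) = h @: closed_nbhd x.
Proof.
apply/setP; elim/codom_caseP => [y|y ny].
  by rewrite (mem_imset _ _ inj_h) !inE (inj_eq inj_h) adj_h.
rewrite inE adj_sym (negPf (isolated _ ny)) orbF.
have /negPf-> : y \notin h @: closed_nbhd x.
  by apply: contra ny => /imsetP[z _ ->]; apply: codom_f.
by apply: contraNF ny => /eqP->; apply: codom_f.
Qed.

Lemma closed_nbhd_isolated y : y \notin codom h -> closed_nbhd y = [set y].
Proof.
by move=> ny; apply/setP => z; rewrite !inE (negPf (isolated _ ny)) orbF.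
Qed.

(** The vertices of [X] are isolated, so they dominate only themselves. *)
Lemma dominated_embed S X : [disjoint X & codom h] ->
  dominated (h @: S :|: X) = h @: dominated S :|: X.
Proof.
move=> dX; rewrite /dominated bigcup_setU; congr (_ :|: _).
  rewrite big_imset /=; last by move=> x y _ _ /inj_h.
  rewrite (big_morph (fun A : {set G} => h @: A) (imsetU h) (imset0 h)).
  by apply: eq_bigr => x _; rewrite closed_nbhd_embed.
rewrite (eq_bigr (fun y => [set y])) => [|y yX]; last first.
  by rewrite closed_nbhd_isolated // (disjointFr dX).
apply/setP => y; apply/bigcupP/idP => [[z zX /set1P->] // | yX].
by exists y; rewrite ?inE.
Qed.

Lemma legal_embed S X x : [disjoint X & codom h] ->
  legal (h @: S :|: X) (h x) = legal S x.
Proof.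
move=> dX; rewrite /legal dominated_embed // closed_nbhd_embed; congr (~~ _).
apply/subsetP/subsetP => [sub y xy | sub y /imsetP[z xz ->]].
  have := sub _ (imset_f h xy).
  rewrite inE (mem_imset _ _ inj_h) => /orP[//|hyX].
  by have := disjointFr dX hyX; rewrite codom_f.
by rewrite inE imset_f ?sub.
Qed.

Lemma legal_isolated S X y : [disjoint X & codom h] -> y \notin codom h ->
  legal (h @: S :|: X) y = (y \notin X).
Proof.
move=> dX ny; rewrite /legal dominated_embed // closed_nbhd_isolated //.
rewrite sub1set inE; have /negPf-> // : y \notin h @: dominated S.
by apply: contra ny => /imsetP[z _ ->]; apply: codom_f.
Qed.

(** Once every vertex outside the image has been chosen, none of them is legal any more, and the
    legal moves in [H] are exactly the images of those in [G]. *)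
Lemma remaining_isolated_chosen p S :
  remaining p (h @: S :|: [set y | y \notin codom h]) = remaining p S.
Proof.
set C := [set y | _]; have dC : [disjoint C & codom h].
  by rewrite disjoint_subset; apply/subsetP => y; rewrite !inE.
have [n] := ubnP #|~: dominated S|; elim: n p S => // n IHn p S Sn.
have [DS|nS] := eqVneq (dominated S) setT.
  rewrite !remaining_over ?dominated_embed // DS.
  by apply/setP; elim/codom_caseP => y; rewrite !inE ?imset_f // => ->; rewrite orbT.
have IH x : legal S x ->
    remaining (opponent p) (h x |: (h @: S :|: C))
    = remaining (opponent p) (x |: S).
  move=> xS; rewrite setUA -imsetU1; apply: IHn.
  exact: leq_trans (legal_decr xS) _.
have [v [vS -> best_v]] := best_move p nS.
apply: (@remaining_best _ _ _ (h v)); rewrite ?legal_embed ?IH //.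
elim/codom_caseP => [w|y ny]; first by rewrite legal_embed // => wS; rewrite IH ?best_v.
by rewrite legal_isolated // inE ny.
Qed.

(** Invariance under isomorphism, as the case where no vertex lies outside the image. *)
Lemma gdn_embed_surj : (forall y, y \in codom h) ->
  staller_start_gdn H = staller_start_gdn G.
Proof.
move=> onto; rewrite /staller_start_gdn -(remaining_isolated_chosen _ set0).
by congr remaining; apply/setP => y; rewrite imset0 !inE onto.
Qed.

(** * Two extra isolated vertices *)

Variables a b : H.
Hypothesis neq_ab : a != b.
Hypothesis codomNab : forall y, (y \notin codom h) = (y \in [set a; b]).

(* A pass at [a] is answered by a pass at [b], and vice versa. *)
Lemma remaining_two_isolated p S :
  remaining p (h @: S) = (remaining p S).+2.
Proof.
have d0 : [disjoint set0 & codom h] by rewrite disjoint_subset; apply/subsetP => y; rewrite inE.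
have d1 y : y \in [set a; b] -> [disjoint [set y] & codom h].
  by rewrite -codomNab => ny; rewrite disjoint_subset; apply/subsetP => z /set1P->.
have pass2 q (T : {set G}) y z : [set y; z] = [set a; b] ->
    remaining q (z |: (h @: T :|: [set y])) = remaining q T.
  move=> Eyz; rewrite setUCA [z |: [set y]]setUC Eyz.
  rewrite -(remaining_isolated_chosen _ T); congr (remaining _ (_ :|: _)).
  by apply/setP => u; rewrite [RHS]inE codomNab.
have other y : y \in [set a; b] ->
    exists2 z, [set y; z] = [set a; b] & z != y.
  case/set2P=> ->; first by exists b; rewrite // eq_sym.
  by exists a; rewrite // setUC.
have mem2 y z : [set y; z] = [set a; b] ->
    (y \notin codom h) /\ (z \notin codom h).
  by move=> E; rewrite !codomNab -E !inE !eqxx orbT.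
have [n] := ubnP #|~: dominated S|; elim: n p S => // n IHn p S Sn.
rewrite -[h @: S]setU0.
(* If [G] is already dominated, only the two passes remain, and both are forced. *)
have [DS|nS] := eqVneq (dominated S) setT.
  have after_pass y q : y \in [set a; b] ->
      remaining q (h @: S :|: [set y]) = 1.
    move=> yab; have [z Eyz neq_zy] := other y yab.
    have [ny nz] := mem2 _ _ Eyz.
    have Lz : legal (h @: S :|: [set y]) z.
      by rewrite legal_isolated ?d1 // inE.
    apply: (@remaining_best _ _ _ z) => //.
      by rewrite pass2 // remaining_over.
    elim/codom_caseP => [w|w nw].
      by rewrite legal_embed ?d1 // /legal DS subsetT.
    rewrite legal_isolated ?d1 // => wy; have -> : w = z.
      by apply/eqP; move: nw wy; rewrite codomNab -Eyz !inE => /predU1P[->|//]; rewrite eqxx.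
    by rewrite pass2 // remaining_over // no_worse_refl.
  have L y : y \in [set a; b] -> legal (h @: S :|: set0) y.
    by rewrite -codomNab => ny; rewrite legal_isolated // inE.
  rewrite [remaining p S]remaining_over //; apply: (@remaining_best _ _ _ a).
  - by rewrite L // !inE eqxx.
  - by rewrite setU0 [_ |: h @: S]setUC after_pass // !inE eqxx.
  elim/codom_caseP => [w|w]; first by rewrite legal_embed // /legal DS subsetT.
  by rewrite codomNab => wab _; rewrite setU0 [_ |: h @: S]setUC after_pass // no_worse_refl.
have IH x : legal S x ->
    remaining (opponent p) (h x |: (h @: S :|: set0))
    = (remaining (opponent p) (x |: S)).+2.
  move=> xS; rewrite setU0 -imsetU1; apply: IHn.
  exact: leq_trans (legal_decr xS) _.
(* An optimal move [v] of [G] stays optimal in [H]: other moves in the image compare by induction,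
   passes are treated last. *)
have [v [vS E best_v]] := best_move p nS.
rewrite E; apply: (@remaining_best _ _ _ (h v)); rewrite ?legal_embed ?IH //.
elim/codom_caseP => [w|y].
  by rewrite legal_embed // => wS; rewrite IH //; have := best_v w wS; case: (p).
rewrite codomNab => yab _; rewrite setU0 [_ |: h @: S]setUC -E.
(* After a pass at [y] the opponent may pass at [z], which leaves [p] to move from [S] in [G]. The
   opponent's best reply is at least as good for the opponent, so the pass gains nothing for [p]. *)
have [z Eyz neq_zy] := other y yab; have [ny nz] := mem2 _ _ Eyz.
have Lz : legal (h @: S :|: [set y]) z by rewrite legal_isolated ?d1 // inE.
have nSy : dominated (h @: S :|: [set y]) != setT.
  by apply: contraNneq Lz => ->; rewrite subsetT.
have [w [_ Ew best_w]] := best_move (opponent p) nSy.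
have := best_w z Lz; rewrite Ew.
have -> : opponent (opponent p) = p by case: (p).
by rewrite (pass2 _ _ _ _ Eyz); case: (p).
Qed.

Lemma gdn_two_isolated : staller_start_gdn H = (staller_start_gdn G).+2.
Proof.
by rewrite /staller_start_gdn -remaining_two_isolated imset0.
Qed.

End IsolatedVertices.

(** * Adding isolated vertices one at a time *)

Section AddIsolated.
Variable G : sgraph.

Definition add_adj : rel (option G) :=
  fun x y => if (x, y) is (Some x', Some y') then adj x' y' else false.

Lemma add_adj_sym : symmetric add_adj.
Proof. by case=> [x|] [y|] //=; apply: adj_sym. Qed.

Lemma add_adj_irrefl : irreflexive add_adj.
Proof. by case=> [x|] //=; apply: adj_irrefl. Qed.

Definition add_isolated : sgraph := SGraph add_adj_sym add_adj_irrefl.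

Lemma gdn_del_isolated :
  staller_start_gdn (del_vertex (None : add_isolated)) = staller_start_gdn G.
Proof.
pose h (x : G) : del_vertex (None : add_isolated) := Sub (Some x) isT.
have onto y : y \in codom h.
  by case: y => [[x|] nx] //; apply/codomP; exists x; apply: val_inj.
apply: (@gdn_embed_surj _ _ h) => // [x y /(congr1 val)[]//|y z].
by rewrite onto.
Qed.

End AddIsolated.

Lemma gdn_add2_isolated (G : sgraph) :
  staller_start_gdn (add_isolated (add_isolated G)) = (staller_start_gdn G).+2.
Proof.
pose h (x : G) : add_isolated (add_isolated G) := Some (Some x).
have mem_h y : (y \notin codom h) = (y \in [set None; Some None]).
  case: y => [[x|]|]; rewrite !inE ?eqxx ?orbT //.
  - by rewrite (codom_f h x).
  - by apply/codomP=> -[].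
  - by apply/codomP=> -[].
apply: (@gdn_two_isolated _ _ h) (None) (Some None) _ _ => // [x y []//|y z].
by rewrite mem_h => /set2P[]->; case: z => [[]|].
Qed.

Lemma gdn_add_isolated_even (G : sgraph) m :
  staller_start_gdn (iter m.*2 add_isolated G) = staller_start_gdn G + m.*2.
Proof.
elim: m => [|m IHm]; first by rewrite addn0.
by rewrite doubleS !addnS -IHm -gdn_add2_isolated.
Qed.

(** The unpaired vertex is taken to be the one added first, directly to [G]; the others come in
    pairs. *)
Lemma gdn_add_isolated_odd (G : sgraph) m :
  staller_start_gdn (iter m.*2.+1 add_isolated G)
  = staller_start_gdn (add_isolated G) + m.*2.
Proof. by rewrite iterSr gdn_add_isolated_even. Qed.

(** * Evaluation of the game by computation *)

(* The game with vertices encoded as numbers: [L] lists the possible moves, [U]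
   the undominated vertices, and [e v u] says that [v] dominates [u]. *)
Fixpoint play (L : seq nat) (e : rel nat) n p (U : seq nat) : nat :=
  if n is n'.+1 then
    if nilp U then 0 else
    let vals := [seq play L e n' (opponent p) [seq u <- U | ~~ e v u]
                | v <- L & has (e v) U] in
    (match p with
     | Dominator => foldr minn (size L) vals
     | Staller => foldr maxn 0 vals
     end).+1
  else 0.

Section Encoding.
Variables (G : sgraph) (c : G -> nat) (e : rel nat).
Hypothesis e_c : forall x y, e (c x) (c y) = (y \in closed_nbhd x).
Let L := [seq c x | x <- enum G].

Let U (S : {set G}) := [seq c x | x <- enum G & x \notin dominated S].

Lemma remaining_upto_play n p S : remaining_upto n p S = play L e n p (U S).
Proof.
elim: n p S => //= n IHn p S.
have -> : nilp (U S) = (dominated S == setT).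
  rewrite /nilp size_map size_filter -leqn0 leqNgt -has_count.
  rewrite -subTset; apply/hasPn/subsetP => [all_x x _|sub x _].
    by have := all_x x (mem_enum _ _); rewrite negbK.
  by rewrite negbK sub.
case: eqP => // _.
have EU v : U (v |: S) = [seq u <- U S | ~~ e (c v) u].
  rewrite /U filter_map -filter_predI; congr map; apply: eq_filter => x /=.
  by rewrite dominatedU1 inE negb_or e_c.
have EL v : has (e (c v)) (U S) = legal S v.
  rewrite has_map /legal; apply/hasP/subsetPn => -[x].
    by rewrite mem_filter /= e_c => /andP[xS _] xv; exists x.
  by move=> xv xS; exists x; [rewrite mem_filter xS mem_enum | rewrite /= e_c].
(* Matches the default values of the two minima. *)
have size_L : size L = #|G| by rewrite size_map -cardE.
case: p.
all: congr _.+1; rewrite foldrE big_map big_filter big_map /= ?size_L enumT [index_enum _]unlock.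
all: by apply: eq_big => [v|v _]; rewrite ?EL // IHn EU.
Qed.

Lemma gdn_play : staller_start_gdn G = play L e (size L) Staller L.
Proof.
have D0 : dominated (set0 : {set G}) = set0 by rewrite /dominated big_set0.
rewrite /staller_start_gdn /remaining D0 setC0 cardsT remaining_upto_play.
rewrite size_map -cardE; congr play; congr map; rewrite -[RHS]filter_predT.
by apply: eq_filter => x; rewrite D0 inE.
Qed.

End Encoding.

Section OrdGraph.
Variables (n : nat) (e : rel nat).

Definition ord_adj : rel 'I_n := fun x y => (x != y) && (e x y || e y x).

Lemma ord_adj_sym : symmetric ord_adj.
Proof. by move=> x y; rewrite /ord_adj eq_sym orbC. Qed.

Lemma ord_adj_irrefl : irreflexive ord_adj.
Proof. by move=> x; rewrite /ord_adj eqxx. Qed.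

Definition ord_graph : sgraph := SGraph ord_adj_sym ord_adj_irrefl.

(** The bounds reserve the code [n] for an added isolated vertex, which [e] might otherwise join to
    smaller codes. *)
Definition dom_code : rel nat := fun x y =>
  (y == x) || [&& x < n, y < n & e x y || e y x].

Lemma gdn_ord_graph :
  staller_start_gdn ord_graph = play (iota 0 n) dom_code n Staller (iota 0 n).
Proof.
rewrite (@gdn_play ord_graph (@nat_of_ord n) dom_code); last first.
  move=> x y; rewrite inE /dom_code /= /ord_adj !ltn_ord [x == y]eq_sym.
  by rewrite -[(y : nat) == x]/(y == x); case: (y =P x).
by rewrite val_enum_ord size_iota.
Qed.

Lemma gdn_ord_graph_isolated :
  staller_start_gdn (add_isolated ord_graph)
  = play (n :: iota 0 n) dom_code n.+1 Staller (n :: iota 0 n).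
Proof.
pose c (x : add_isolated ord_graph) := if x is Some i then nat_of_ord i else n.
rewrite (@gdn_play _ c dom_code); last first.
  case=> [x|] [y|]; rewrite inE /dom_code /= /add_adj /= ?ltnn ?andbF ?orbF ?eqxx //.
  - rewrite /ord_adj !ltn_ord /=.
    rewrite [Some y == _](inj_eq Some_inj) [x == y]eq_sym.
    by rewrite -[(y : nat) == x]/(y == x); case: (y =P x).
  - by rewrite gtn_eqF.
  - by rewrite ltn_eqF.
(* The enumeration of an option type starts with [None], whose code is [n]. *)
suff -> : [seq c x | x <- enum (add_isolated ord_graph)] = n :: iota 0 n.
  by rewrite /= size_iota.
rewrite enumT unlock /= -map_comp -val_enum_ord; congr (_ :: _).
by rewrite enumT.
Qed.

End OrdGraph.

(** * The two base graphs and the final construction *)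

Definition cycle6 := ord_graph 6 (fun x y => y == x.+1 %% 6).

(* The vertices 0, 1, 2, 3 and 4, 5, 6, 7 are the two copies of P_4. *)
Definition ladder4 :=
  ord_graph 8 (fun x y => (y == x + 4) || (y == x.+1) && (y != 4)).

Lemma gdn_cycle6 : staller_start_gdn cycle6 = 2.
Proof. by rewrite gdn_ord_graph; vm_compute. Qed.

Lemma gdn_cycle6_isolated : staller_start_gdn (add_isolated cycle6) = 4.
Proof. by rewrite gdn_ord_graph_isolated; vm_compute. Qed.

Lemma gdn_ladder4 : staller_start_gdn ladder4 = 3.
Proof. by rewrite gdn_ord_graph; vm_compute. Qed.

Lemma gdn_ladder4_isolated : staller_start_gdn (add_isolated ladder4) = 5.
Proof. by rewrite gdn_ord_graph_isolated; vm_compute. Qed.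

Theorem proposition3p3 (l : nat) (hl : 4 <= l) :
  exists (G : sgraph) (v : G),
    staller_start_gdn G = l /\ staller_start_gdn (del_vertex v) = l - 2.
Proof.
pose K := if odd l then ladder4 else cycle6.
have K0 : staller_start_gdn K = odd l + 2.
  by rewrite /K; case: (odd l); rewrite ?gdn_ladder4 ?gdn_cycle6.
have K1 : staller_start_gdn (add_isolated K) = odd l + 4.
  by rewrite /K; case: (odd l); rewrite ?gdn_ladder4_isolated ?gdn_cycle6_isolated.
(* Each pair of isolated vertices adds 2 to both values, which start at 4 and 2 for even [l], at 5
   and 3 for odd [l]. By [hl] the subtraction is not truncated. *)
pose m := l./2 - 2.
have El : odd l + 4 + m.*2 = l.
  rewrite -[RHS]odd_double_half -addnA; congr (_ + _).
  by rewrite doubleB subnKC // (leq_double 2) (half_leq hl).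
(* The removed vertex is the isolated vertex added last, so an odd number of them becomes even. *)
exists (add_isolated (iter m.*2 add_isolated K)), None; split.
  by rewrite -iterS gdn_add_isolated_odd K1.
rewrite gdn_del_isolated gdn_add_isolated_even K0 -[X in X - 2]El.
by rewrite -[4]/(2 + 2) addnA -[_ + 2 + 2 + _]addnAC addnK.
Qed.
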